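(* There are constants $d_0$ and $c$ such that the following holds. For every integer $d \geq d_0$, there is a $1$-factorisation $\mathcal{M}$ of the $d$-dimensional hypercube $Q_d$ such that, for every $\mathcal{N} \subseteq \mathcal{M}$ with $|\mathcal{N}| \geq c \log_2 d$, the union $\bigcup \mathcal{N}$ (the spanning subgraph of $Q_d$ whose edge set is the union of the perfect matchings in $\mathcal{N}$) is connected. In fact, one can take $d_0 = 3000$ and $c = 45$. In particular, $r(d) = O(\log d)$, where $r(d)$ is the minimal positive integer $r$ such that some $1$-factorisation of $Q_d$ has the property that the union of any $r$ distinct $1$-factors is connected.
   Context: $Q_d$ is the graph on $\{0,1\}^d$ in which two vertices are adjacent if and only if they differ in exactly one coordinate. A $1$-factorisation of a regular graph $G$ is a partition $\mathcal{M} = \{M_1, \dots, M_k\}$ of its edge set into perfect matchings of $G$ (for $Q_d$, $k = d$). *)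

(* Defs.v *)
From HB Require Import structures.
From mathcomp Require Import all_boot all_order all_algebra.

Set Implicit Arguments.
Unset Strict Implicit.
Unset Printing Implicit Defensive.

(* A graph on a finite vertex type T is an adjacency relation [adj : rel T];
   an edge is the set of its two ends, and a spanning subgraph is given by its
   set of edges. *)
Section Graphs.

Variables (T : finType) (adj : rel T).

Definition edges : {set {set T}} :=
  [set e | [exists x, exists y, adj x y && (e == [set x; y])]].

Definition perfect_matching (M : {set {set T}}) : bool :=
  (M \subset edges) && [forall x : T, #|[set e in M | x \in e]| == 1].

Definition one_factorisation (F : {set {set {set T}}}) : bool :=
  partition F edges && [forall M in F, perfect_matching M].

End Graphs.

Definition edge_rel (T : finType) (E : {set {set T}}) : rel T :=
  fun x y => [set x; y] \in E.

Definition connected_spanning (T : finType) (E : {set {set T}}) : bool :=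
  [forall x : T, forall y : T, connect (edge_rel E) x y].

Definition cube (d : nat) := {ffun 'I_d -> bool}.

HB.instance Definition _ d := Finite.on (cube d).

Definition cube_adj (d : nat) : rel (cube d) :=
  fun x y => #|[set i | x i != y i]| == 1.

Definition any_union_connected (d r : nat) (F : {set {set {set cube d}}}) : bool :=
  [forall N : {set {set {set cube d}}},
    (N \subset F) && (#|N| == r) ==> connected_spanning (cover N)].

Definition admissible (d r : nat) : bool :=
  (0 < r) && [exists F : {set {set {set cube d}}},
    one_factorisation (@cube_adj d) F && any_union_connected r F].

(* The factorisation of the cube by the direction of the edges witnesses that
   the minimum defining [r_cube] exists. *)
Section DirectionFactorisation.

Variable d : nat.
Implicit Types (x y : cube d) (i j : 'I_d).

Definition flip i x : cube d := [ffun j => if j == i then ~~ x j else x j].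

Definition dir_edge i x : {set cube d} := [set x; flip i x].

Definition dir_matching i : {set {set cube d}} := [set dir_edge i x | x : cube d].

Definition dir_factorisation : {set {set {set cube d}}} :=
  [set dir_matching i | i : 'I_d].

Lemma flipK i : involutive (flip i).
Proof.
by move=> x; apply/ffunP=> j; rewrite !ffunE; case: eqP => //; rewrite negbK.
Qed.

Lemma flip_diff i x : [set j | x j != flip i x j] = [set i].
Proof.
apply/setP=> j; rewrite !inE ffunE; case: (j =P i) => _; last by rewrite eqxx.
by case: (x j).
Qed.

Lemma dir_edge_eq i x y : y \in dir_edge i x -> dir_edge i x = dir_edge i y.
Proof.
by case/set2P=> ->; rewrite // /dir_edge flipK setUC.
Qed.

Lemma cube_adjP x y : reflect (exists i, y = flip i x) (cube_adj x y).
Proof.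
apply: (iffP idP) => [/cards1P[i Hi]|[i ->]]; last first.
  by rewrite /cube_adj flip_diff cards1.
exists i; apply/ffunP=> j; rewrite ffunE.
move/setP/(_ j): Hi; rewrite !inE => <-.
by case: (x j); case: (y j).
Qed.

Lemma dir_matching_edges i : dir_matching i \subset edges (@cube_adj d).
Proof.
apply/subsetP=> _ /imsetP[x _ ->]; rewrite inE.
apply/existsP; exists x; apply/existsP; exists (flip i x).
by rewrite eqxx andbT; apply/cube_adjP; exists i.
Qed.

Lemma dir_matching_perfect i : perfect_matching (@cube_adj d) (dir_matching i).
Proof.
rewrite /perfect_matching dir_matching_edges; apply/forallP=> x.
apply/cards1P; exists (dir_edge i x); apply/setP=> e; rewrite !inE.
apply/andP/eqP=> [[/imsetP[y _ ->] /dir_edge_eq //]|->].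
by split; [apply: imset_f | rewrite set21].
Qed.

Lemma dir_matching_inj i j (e : {set cube d}) :
  e \in dir_matching i -> e \in dir_matching j -> i = j.
Proof.
case/imsetP=> x _ ->; case/imsetP=> y _ Exy.
have xy : x \in dir_edge j y by rewrite -Exy set21.
have: flip i x \in dir_edge j x by rewrite -(dir_edge_eq xy) -Exy set22.
case/set2P=> E.
  by have := flip_diff i x; rewrite E => /setP/(_ i); rewrite !inE !eqxx.
have := flip_diff i x; rewrite E flip_diff => /setP/(_ i).
by rewrite !inE eqxx => /eqP.
Qed.

Lemma dir_factorisationP : one_factorisation (@cube_adj d) dir_factorisation.
Proof.
apply/andP; split; last first.
  by apply/forall_inP=> _ /imsetP[i _ ->]; apply: dir_matching_perfect.
apply/and3P; split.
- apply/eqP/setP=> e; apply/bigcupP/idP=> [[_ /imsetP[i _ ->]]|].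
    exact/subsetP/dir_matching_edges.
  rewrite inE => /existsP[x /existsP[y /andP[/cube_adjP[i ->] /eqP->]]].
  by exists (dir_matching i); apply: imset_f.
- apply/trivIsetP=> _ _ /imsetP[i _ ->] /imsetP[j _ ->] ne.
  rewrite -setI_eq0; apply/eqP/setP=> e; rewrite !inE.
  apply/negP=> /andP[ei ej]; case/eqP: ne.
  by rewrite (dir_matching_inj ei ej).
- apply/negP=> /imsetP[i _ /setP/(_ (dir_edge i [ffun=> false]))].
  by rewrite inE imset_f.
Qed.

End DirectionFactorisation.

Lemma admissible_exists (d : nat) : exists r, admissible d r.
Proof.
exists #|dir_factorisation d|.+1; apply/andP; split=> //.
apply/existsP; exists (dir_factorisation d); rewrite dir_factorisationP.
apply/forallP=> N; apply/implyP=> /andP[/subset_leq_card le_N /eqP EN].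
by rewrite EN ltnn in le_N.
Qed.

Definition r_cube (d : nat) : nat := ex_minn (admissible_exists d).

(* Imported only here because it shadows finset names such as [cover]. *)
From mathcomp Require Import all_classical all_reals all_analysis.
Import Order.TTheory GRing.Theory Num.Theory.
Import numFieldNormedType.Exports.
Local Open Scope ring_scope.

Definition log2 (R : realType) (x : R) : R := ln x / ln 2.

Definition robust_factorisations (R : realType) (d0 : nat) (c : R) : Prop :=
  forall d : nat, (d0 <= d)%N ->
    exists2 F : {set {set {set cube d}}},
      one_factorisation (@cube_adj d) F &
      forall N : {set {set {set cube d}}},
        N \subset F -> c * log2 d%:R <= #|N|%:R ->
        connected_spanning (finset.cover N).

(* Main.v *)
(* Label the vertices of the cube by ordered pairs of directions, and start from
   the factorisation by directions.  On every face in directions [i], [j] whose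
   four vertices all have label [(i, j)], exchange the colours [i] and [j]; such
   faces are disjoint, so this is again a 1-factorisation.  By counting
   labellings, one of them is such that, for every set [A] of directions with
   [8 * d ^ 9 <= 2 ^ #|A|], every subcube with free directions [A] meets an
   exchanged face in directions [i], [j] for all [i] in [A] and [j] outside [A].
   Then the colours in [A] connect each subcube: a vertex misses at most one of
   its edges there, so if the ends of a missing edge in direction [i] were not
   connected, going around squares would show that every edge in direction [i]
   of the subcube is missing, whereas the edges in direction [i] at an exchanged
   face in directions [i' != i] and [j] are present.  The exchanged faces also
   give, from each subcube, an edge in every direction outside [A]. *)
Require Import Defs.
From mathcomp Require Import all_boot all_order all_algebra.
From mathcomp Require Import perm zify.

Set Implicit Arguments.
Unset Strict Implicit.
Unset Printing Implicit Defensive.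

(** * Flips and subcubes *)

Lemma flip_inj d (x : cube d) : injective (fun i => flip i x).
Proof.
move=> i j E; have := flip_diff i x; rewrite E flip_diff.
by move/setP/(_ i); rewrite !inE eqxx => /eqP.
Qed.

Lemma flipC d (i k : 'I_d) (x : cube d) : flip i (flip k x) = flip k (flip i x).
Proof. by apply/ffunP=> l; rewrite !ffunE; do 2!case: eqP. Qed.

(** Induction on the number of coordinates where [y] differs from [x]: each of them lies in [A], and
    flipping one lowers the count. *)
Lemma subcube_ind d (A : {set 'I_d}) (P : cube d -> Prop) (x : cube d) :
  P x -> (forall y k, k \in A -> P y -> P (flip k y)) ->
  forall y : cube d, (forall k, k \notin A -> y k = x k) -> P y.
Proof.
move=> Px PA y; have [n] := ubnP #|[set k | y k != x k]|.
elim: n y => // n IHn y ltn yx.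
have [E|[k]] := set_0Vmem [set k | y k != x k].
  suff -> : y = x by [].
  by apply/ffunP=> k; apply/eqP; move/setP/(_ k): E; rewrite !inE => /negbFE.
rewrite inE => ykx.
have kA : k \in A by apply: contraR ykx => /yx ->.
rewrite -(flipK k y); apply: PA => //; apply: IHn; last first.
  by move=> l lA; rewrite ffunE; case: eqP => [lk|_]; [rewrite lk kA in lA | apply: yx].
rewrite ltnS in ltn; apply: leq_trans ltn; apply: proper_card.
apply/properP; split; last first.
  by exists k; rewrite inE // ffunE eqxx; case: (y k) ykx; case: (x k).
apply/subsetP=> l; rewrite !inE ffunE; have [->|_] := eqVneq l k; last by [].
by rewrite ykx.
Qed.

(** * Factorisations obtained from a transposition of colours at each vertex *)

Section Colouring.

(* At the vertex [x], the edge in direction [k] has colour [s x k], where [s x]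
   is the transposition of the pair [p x] (the identity when [p x] is diagonal). *)
Variables (d : nat) (p : cube d -> 'I_d * 'I_d).
Let s x := tperm (p x).1 (p x).2.
Hypothesis s_flip : forall x k, s (flip k x) k = s x k.

Let sK x : involutive (s x).
Proof. exact: tpermK. Qed.

Definition colour_class c : {set {set cube d}} :=
  [set dir_edge (s x c) x | x : cube d].

Definition colour_classes : {set {set {set cube d}}} :=
  [set colour_class c | c : 'I_d].

(** By [s_flip] an edge gets the same colour from both ends, so the class has only one edge at each
    vertex. *)
Lemma colour_class_edge c (x : cube d) e :
  e \in colour_class c -> x \in e -> e = dir_edge (s x c) x.
Proof.
case/imsetP=> y _ -> xy; rewrite (dir_edge_eq xy).
case/set2P: xy => -> //; congr (dir_edge _ _).
by apply: (inv_inj (sK (flip (s y c) y))); rewrite s_flip !sK.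
Qed.

Lemma colour_class_edges c : colour_class c \subset edges (@cube_adj d).
Proof.
apply/subsetP=> _ /imsetP[x _ ->]; rewrite inE.
apply/existsP; exists x; apply/existsP; exists (flip (s x c) x).
by rewrite eqxx andbT; apply/cube_adjP; exists (s x c).
Qed.

Lemma colour_class_perfect c : perfect_matching (@cube_adj d) (colour_class c).
Proof.
rewrite /perfect_matching colour_class_edges; apply/forallP=> x.
apply/cards1P; exists (dir_edge (s x c) x); apply/setP=> e; rewrite !inE.
apply/andP/eqP=> [[eM xe]|->]; first exact: colour_class_edge.
by split; [apply: imset_f | rewrite set21].
Qed.

Lemma colour_class_inj c c' e :
  e \in colour_class c -> e \in colour_class c' -> c = c'.
Proof.
move=> ec ec'; case/imsetP: (ec) => x _ Ee.
have xe : x \in e by rewrite Ee set21.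
have := colour_class_edge ec' xe; rewrite Ee => E.
have: flip (s x c) x \in dir_edge (s x c') x by rewrite -E set22.
case/set2P=> [F|/flip_inj /(inv_inj (sK x)) //].
by have := flip_diff (s x c) x; rewrite F => /setP/(_ (s x c)); rewrite !inE !eqxx.
Qed.

Lemma colour_classes_factorisation :
  one_factorisation (@cube_adj d) colour_classes.
Proof.
apply/andP; split; last first.
  by apply/forall_inP=> _ /imsetP[c _ ->]; apply: colour_class_perfect.
apply/and3P; split.
- apply/eqP/setP=> e; apply/bigcupP/idP=> [[_ /imsetP[c _ ->]]|].
    exact/subsetP/colour_class_edges.
  rewrite inE => /existsP[x /existsP[y /andP[/cube_adjP[i ->] /eqP->]]].
  exists (colour_class (s x i)); first exact: imset_f.
  by apply/imsetP; exists x => //; rewrite sK.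
- apply/trivIsetP=> _ _ /imsetP[i _ ->] /imsetP[j _ ->] ne.
  rewrite -setI_eq0; apply/eqP/setP=> e; rewrite !inE.
  apply/negP=> /andP[ei ej]; case/eqP: ne.
  by rewrite (colour_class_inj ei ej).
- apply/negP=> /imsetP[c _ ].
  pose x : cube d := [ffun=> false].
  have: dir_edge (s x c) x \in colour_class c by apply: imset_f.
  by move=> /[swap] <-; rewrite inE.
Qed.

Lemma colour_union_connected (N : {set {set {set cube d}}}) :
  let A := [set c | colour_class c \in N] in
  1 < #|A| ->
  (forall (x : cube d) i j, i \in A -> j \notin A ->
     exists2 y : cube d, forall k, k \notin A -> y k = x k & p y = (i, j)) ->
  connected_spanning (cover N).
Proof.
move=> A A_gt1 p_swap; set conn := connect (edge_rel (cover N)).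
have connC : symmetric conn.
  by apply: sym_connect_sym => x y; rewrite /edge_rel setUC.
have conn_edge x k : s x k \in A -> conn x (flip k x).
  rewrite inE => kN; apply: connect1; apply/bigcupP.
  by exists (colour_class (s x k)) => //; apply/imsetP; exists x => //; rewrite sK.
(* The [i]-edge at [y] must have a colour outside [A], so [s y] swaps [i] with a direction outside
   [A] and fixes every other [k] in [A]. *)
have nconn_next y i k : i \in A -> k \in A -> i != k ->
    ~~ conn y (flip i y) -> conn y (flip k y).
  move=> iA kA ik ncy; apply/conn_edge.
  have siA : s y i \notin A by apply: contra ncy; apply/conn_edge.
  move: siA; rewrite /s; case: (tpermP _ _ i) => [Ei|Ei|]; last by rewrite iA.
    move=> bA; case: tpermP => // [Ea|Eb]; first by rewrite Ei Ea eqxx in ik.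
    by rewrite -Eb kA in bA.
  move=> bA; case: tpermP => // [Ea|Eb]; last by rewrite Ei Eb eqxx in ik.
  by rewrite -Ea kA in bA.
have conn_in x i : i \in A -> conn x (flip i x).
  move=> iA; apply/negPn/negP => ncx.
  have ncx_all : forall y : cube d, (forall k, k \notin A -> y k = x k) -> ~~ conn y (flip i y).
    apply: subcube_ind => // y k kA ncy.
    have [<-|ik] := eqVneq i k; first by rewrite flipK connC.
    (* Both [k]-sides of the square are present, so joining the ends of its far [i]-side would join
       those of the near one. *)
    have c1 := nconn_next _ _ _ iA kA ik ncy.
    have c2 : conn (flip i y) (flip k (flip i y)).
      by apply: nconn_next iA kA ik _; rewrite flipK connC.
    apply: contra ncy => c3; apply: connect_trans c1 _.
    by apply: connect_trans c3 _; rewrite flipC -/conn connC.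
  have [i' i'A ii'] : exists2 i', i' \in A & i' != i.
    by case/card_gt1P: A_gt1 => a [b [aA bA ab]]; have [ai|] := eqVneq a i;
      [exists b; rewrite // -ai eq_sym | exists a].
  have jA : s x i \notin A by apply: contra ncx; apply/conn_edge.
  (* The direction [s x i] lies outside [A]. The swap at [y] exchanges it with [i'] and fixes [i],
     so the [i]-edge at [y] has colour [i], in [A]. *)
  have [y yx py] := p_swap x i' (s x i) i'A jA.
  move/negP: (ncx_all y yx); apply; apply/conn_edge.
  rewrite /s py /= tpermD // eq_sym.
  by apply: contraNneq jA => {1}<-.
have conn_subcube (x y : cube d) : (forall k, k \notin A -> y k = x k) -> conn x y.
  move: y; apply: subcube_ind => [|y k kA cxy]; first exact: connect0.
  by apply: connect_trans cxy (conn_in _ _ kA).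
have conn_flip x j : conn x (flip j x).
  have [/conn_in //|jA] := boolP (j \in A).
  have [i iA] : exists i, i \in A by apply/card_gt0P; apply: ltn_trans A_gt1.
  (* At [y] the [j]-edge has colour [i]: it leads from the subcube of [x] to that of [flip j x]. *)
  have [y yx py] := p_swap x i j iA jA.
  apply: connect_trans (conn_subcube _ _ yx) _.
  apply: (@connect_trans _ _ (flip j y)).
    by apply/conn_edge; rewrite /s py /= tpermR.
  by apply: conn_subcube => k kA; rewrite !ffunE yx.
apply/forallP=> x; apply/forallP=> y.
apply: (@subcube_ind _ setT (conn x) x) => [|z k _ cxz|k]; first exact: connect0.
  exact: connect_trans cxz (conn_flip _ _).
by rewrite inE.
Qed.

End Colouring.

(** * Counting labellings *)

Lemma leq_double_expn q : 0 < q -> 2 * q ^ q <= q.+1 ^ q.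
Proof.
(* Bernoulli's inequality (1 + 1/q)^n >= 1 + n/q, cleared of denominators. *)
move=> q_gt0; suff bern n : q ^ n * (q + n) <= q * q.+1 ^ n.
  by rewrite -(leq_pmul2l q_gt0); apply: leq_trans (bern q); rewrite addnn; lia.
elim: n => [|n IHn]; first by rewrite !expn0; lia.
rewrite !expnSr mulnA; apply: (@leq_trans (q ^ n * (q + n) * q.+1)).
  by rewrite -!mulnA leq_mul2l; apply/orP; right; lia.
by rewrite leq_mul2r IHn orbT.
Qed.

(** The exponent [L] contains [m] blocks of length [q], each contributing (1 + 1/q)^q >= 2. *)
Lemma leq_expn2_ratio q m L : 0 < q -> q * m <= L -> 2 ^ m * q ^ L <= q.+1 ^ L.
Proof.
move=> q_gt0 /subnK <-; rewrite addnC !expnD mulnA !expnM -expnMn.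
have expS a b e : a <= b -> a ^ e <= b ^ e by case: e => // e; rewrite leq_exp2r.
by rewrite leq_mul ?expS // leq_double_expn.
Qed.

(* The decoding map [D] makes the tuples [F t] pairwise disjoint, so the events
   "f is constantly b on [F t]" are independent; overwriting [f] by [b] on one
   [F t] turns this independence into an injection. *)
Lemma card_avoiding (A B T : finType) n (b : B) (F : T -> n.-tuple A)
    (D : A -> T) (l : seq T) :
  uniq l -> (forall t, t \in l -> forall a, a \in F t -> D a = t) ->
  (#|B| ^ n) ^ size l *
    #|[set f : {ffun A -> B} | all (fun t => has (fun a => f a != b) (F t)) l]|
  <= (#|B| ^ n).-1 ^ size l * #|B| ^ #|A|.
Proof.
set Q := #|B| ^ n; pose G s := [set f : {ffun A -> B} |
  all (fun t => has (fun a => f a != b) (F t)) s].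
have Q_gt0 : 0 < Q by rewrite expn_gt0; apply/orP; left; apply/card_gt0P; exists b.
rewrite -/(G l); elim: l => [|t l IHl] /=.
  by rewrite !expn0 !mul1n -card_ffun max_card.
case/andP=> tl ul Dl.
pose H := [set f in G l | all (fun a => f a == b) (F t)].
have EG : #|G l| = #|G (t :: l)| + #|H|.
  have hasC f : has (fun a => f a != b) (F t) = ~~ all (fun a => f a == b) (F t).
    by rewrite -has_predC.
  rewrite -(cardsID H) addnC; congr (_ + _); apply: eq_card => f; rewrite !inE /= ?hasC.
    by case: (all _ l); case: (all _ (F t)).
  by case: (all _ l).
have leH : #|G l| <= #|H| * Q.
  pose ow (f : {ffun A -> B}) := [ffun a => if a \in F t then b else f a].
  pose phi f := (ow f, map_tuple f (F t)).
  have phi_inj : injective phi.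
    move=> f g [/ffunP Eow Et]; apply/ffunP=> a.
    have := Eow a; rewrite !ffunE; case: ifP => // aF _.
    by move/eq_in_map: Et; apply.
  rewrite -(card_imset _ phi_inj) /Q -card_tuple -cardsT -cardsX subset_leq_card //.
  apply/subsetP=> _ /imsetP[f fG ->]; rewrite !inE andbT; apply/andP; split.
    move: fG; rewrite inE => /allP fG; apply/allP=> u ul'.
    have /hasP[a aF fa] := fG u ul'; apply/hasP; exists a => //; rewrite ffunE.
    case: ifP => // aFt; move: tl; rewrite -(Dl _ (mem_head _ _) _ aFt).
    by rewrite (Dl u _ _ aF) ?ul' // inE ul' orbT.
  by apply/allP=> a aF; rewrite ffunE aF.
(* At least a fraction 1/Q of [G l] lies in [H], so at most (Q-1)/Q of it survives. *)
have step : Q * #|G (t :: l)| <= Q.-1 * #|G l|.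
  by rewrite -(leq_add2r (#|H| * Q)) [#|H| * Q]mulnC -mulnDr -EG mulnC; nia.
have {}IHl := IHl ul (fun u ul' => Dl u (mem_behead (s := t :: l) ul')).
rewrite expnSr -mulnA; apply: leq_trans (leq_mul (leqnn _) step) _.
by rewrite mulnCA expnS -mulnA leq_mul2l IHl orbT.
Qed.

Definition face d (i j : 'I_d) (y : cube d) : 4.-tuple (cube d) :=
  [tuple y; flip i y; flip j y; flip i (flip j y)].

(** A union bound: each good event has a bad set of density at most 2^(-4d), and there are 4^d d^2 <
    2^(4d) events in all. *)
Lemma exists_labelling d : 0 < d -> exists h : {ffun cube d -> 'I_d * 'I_d},
  forall (x : cube d) (N : {set 'I_d}) i j,
    i \in N -> j \notin N -> 8 * d ^ 9 <= 2 ^ #|N| ->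
    exists2 y : cube d, forall k, k \notin N -> y k = x k
                      & all (fun z => h z == (i, j)) (face i j y).
Proof.
move=> d_gt0; pose vert (x : cube d) (N Z : {set 'I_d}) : cube d :=
  [ffun k => if k \in N then k \in Z else x k].
(* Fixing coordinate [i] to false makes the faces disjoint: the coordinates in [N :\ i] of any of
   the four vertices give back [Z]. *)
pose trials (N : {set 'I_d}) i := enum (powerset (N :\ i)).
pose event := (cube d * {set 'I_d} * ('I_d * 'I_d))%type.
pose good (e : event) := let: (x, N, (i, j)) := e in
  [&& i \in N, j \notin N & 8 * d ^ 9 <= 2 ^ #|N|].
pose bad (e : event) := let: (x, N, (i, j)) := e in
  [set h : {ffun cube d -> 'I_d * 'I_d} |
    all (fun Z => has (fun z => h z != (i, j)) (face i j (vert x N Z))) (trials N i)].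
have card_bad e : good e -> 2 ^ (4 * d) * #|bad e| <= (d * d) ^ #|{: cube d}|.
  case: e => [[x N] [i j]] /and3P[iN jN leN].
  have d_gt1 : 1 < d.
    have : i != j by apply: contraNneq jN => <-.
    by case: (i) (j) => [a al] [c cl]; rewrite -val_eqE /=; lia.
  have := @card_avoiding _ _ _ 4 (i, j) (fun Z => face i j (vert x N Z))
    (fun a => [set k in N :\ i | a k]) (trials N i) (enum_uniq _).
  rewrite card_prod card_ord -cardE card_powerset.
  rewrite (cardsD1 i N) iN expnS in leN.
  set Q := (d * d) ^ 4; set L := 2 ^ #|N :\ i|; set V := #|_|; rewrite -/(bad (x, N, (i, j))).
  have EQ : Q = d ^ 8 by rewrite /Q mulnn -expnM.
  have Q_gt1 : 1 < Q by rewrite EQ (leq_trans d_gt1) // expnS leq_pmulr // expn_gt0 (ltnW d_gt1).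
  (* The threshold 8 d^9 is made for this: Q = d^8 and L = 2^(|N|-1) >= 4 d^9. *)
  have leL : Q.-1 * (4 * d) <= L.
    rewrite -EQ add1n expnS -/L in leN.
    by apply: (@leq_trans (Q * (4 * d))); [rewrite leq_mul2r leq_pred orbT | lia].
  have q_gt0 : 0 < Q.-1 by lia.
  have := leq_expn2_ratio q_gt0 leL; rewrite prednK ?(ltnW Q_gt1) // => ratio.
  move=> /(_ _)/wrap[].
    move=> Z; rewrite mem_enum powersetE => /subsetP ZN a aF.
    apply/setP=> k; rewrite !inE.
    have [ki|ki] := eqVneq k i; first by apply/esym/negbTE/negP => /ZN; rewrite ki !inE eqxx.
    have [kN|kN] := boolP (k \in N); last first.
      by apply/esym/negbTE; apply: contra kN => /ZN; rewrite !inE => /andP[].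
    have kj : k != j by apply: contraNneq jN => <-.
    by move: aF; rewrite !inE => /or4P[] /eqP ->; rewrite !ffunE ?(negbTE ki) ?(negbTE kj) kN.
  rewrite -/(bad (x, N, (i, j))) => le_bad.
  have qL_gt0 : 0 < Q.-1 ^ L by rewrite expn_gt0 q_gt0.
  rewrite -(leq_pmul2l qL_gt0); apply: leq_trans le_bad.
  by rewrite mulnA leq_mul2r mulnC ratio orbT.
have [h hgood] : exists h, h \notin \bigcup_(e | good e) bad e.
  apply/existsP; rewrite -negb_forall; apply/negP => /forallP all_bad.
  have cover_bad : (d * d) ^ #|{: cube d}| <= \sum_(e | good e) #|bad e|.
    have <- : #|{: 'I_d * 'I_d}| = d * d by rewrite card_prod card_ord.
    rewrite -card_ffun -cardsT.
    have -> : setT = \bigcup_(e | good e) bad e.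
      by apply/setP=> h; rewrite inE all_bad.
    apply: (big_ind2 (fun (S : {set _}) m => #|S| <= m)) => [|S m S' m' le le'|//].
      by rewrite cards0.
    by apply: leq_trans (leq_card_setU _ _) (leq_add le le').
  have := leq_mul (leqnn (2 ^ (4 * d))) cover_bad; rewrite big_distrr /=.
  apply/negP; rewrite -ltnNge.
  apply: (@leq_ltn_trans (\sum_(e : event | good e) (d * d) ^ #|{: cube d}|)).
    exact: leq_sum.
  rewrite sum_nat_const.
  apply: (@leq_ltn_trans (#|{: event}| * (d * d) ^ #|{: cube d}|)).
    by rewrite leq_mul2r max_card orbT.
  rewrite ltn_pmul2r; last by rewrite expn_gt0 muln_gt0 d_gt0.
  have card_sets : #|{: {set 'I_d}}| = 2 ^ d.
    by rewrite -cardsT -powersetT card_powerset cardsT card_ord.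
  rewrite !card_prod !card_ord card_sets card_ffun card_bool card_ord -expnD mulnn.
  rewrite (_ : 4 * d = d + d + (d * 2)); last by lia.
  by rewrite [ltnRHS]expnD ltn_pmul2l ?expn_gt0 // expnM ltn_exp2r // ltn_expl.
exists h => x N i j iN jN leN.
have : h \notin bad (x, N, (i, j)).
  apply: contra hgood => hb; apply/bigcupP; exists (x, N, (i, j)) => //.
  exact/and3P.
rewrite inE => /allPn[Z _]; rewrite -all_predC => Zh; exists (vert x N Z).
  by move=> k kN; rewrite ffunE (negbTE kN).
by apply: sub_all Zh => z /=; rewrite negbK.
Qed.

(** * Exchanging colours on the uniformly labelled faces *)

Section Swaps.

Variables (d : nat) (h : cube d -> 'I_d * 'I_d).

(** The label of [x] itself selects the only face that may be exchanged at [x]; the diagonal default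
    gives the identity transposition. *)
Definition swap_pair (x : cube d) : 'I_d * 'I_d :=
  let: (i, j) := h x in
  if all (fun z => h z == (i, j)) (face i j x) then (i, j) else (i, i).

Lemma swap_pair_face i j y :
  all (fun z => h z == (i, j)) (face i j y) -> swap_pair y = (i, j).
Proof. by move=> hy; rewrite /swap_pair; case/andP: (hy) => /eqP -> _; rewrite hy. Qed.

Lemma swap_pair_flip i j k y :
  all (fun z => h z == (i, j)) (face i j y) -> k \in [:: i; j] ->
  swap_pair (flip k y) = (i, j).
Proof.
move=> /and5P[h1 h2 h3 h4 _]; rewrite !inE => kij; apply: swap_pair_face.
by case/orP: kij => /eqP -> /=; rewrite ?(flipC j i) ?flipK h1 h2 h3 ?(flipC j i) ?flipK ?h1 ?h2 ?h3 ?h4.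
Qed.

(** If the transposition at either end moves [k], then [k] is a direction of the exchanged face
    there, so the other end lies on the same face. Otherwise both fix [k]. *)
Lemma swap_perm_flip x k :
  tperm (swap_pair (flip k x)).1 (swap_pair (flip k x)).2 k
  = tperm (swap_pair x).1 (swap_pair x).2 k.
Proof.
have key y : tperm (swap_pair y).1 (swap_pair y).2 k != k ->
    swap_pair (flip k y) = swap_pair y.
  rewrite {1 2 4}/swap_pair; case hy: (h y) => [i j].
  case: ifP => [hf|_] /=; last by rewrite tperm1 perm1 eqxx.
  move=> nk; apply: swap_pair_flip => //; rewrite !inE.
  by apply: contraNT nk; rewrite negb_or => /andP[ki kj]; rewrite tpermD // eq_sym.
have [E|/key -> //] := eqVneq (tperm (swap_pair x).1 (swap_pair x).2 k) k.
have [-> //|/key] := eqVneq (tperm (swap_pair (flip k x)).1 (swap_pair (flip k x)).2 k) k.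
by rewrite flipK => ->.
Qed.

End Swaps.

Lemma robust_factorisation_exists d : 0 < d ->
  exists2 F : {set {set {set cube d}}}, one_factorisation (@cube_adj d) F &
    forall N : {set {set {set cube d}}},
      N \subset F -> 8 * d ^ 9 <= 2 ^ #|N| -> connected_spanning (cover N).
Proof.
move=> d_gt0; have [h hP] := exists_labelling d_gt0.
exists (colour_classes (swap_pair h)); first exact: colour_classes_factorisation (swap_perm_flip h).
move=> N NF leN; set A := [set c | colour_class (swap_pair h) c \in N].
have leA : 8 * d ^ 9 <= 2 ^ #|A|.
  apply: leq_trans leN _; rewrite leq_exp2l //.
  apply: leq_trans (leq_imset_card (colour_class (swap_pair h)) A).
  apply/subset_leq_card/subsetP=> M MN; have /imsetP[c _ EM] := subsetP NF _ MN.
  by apply/imsetP; exists c; rewrite // inE -EM.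
have A_gt1 : 1 < #|A|.
  (* The factor 8 in the threshold already forces three colours. *)
  have : 2 ^ 3 <= 2 ^ #|A| by apply: leq_trans leA; rewrite leq_pmulr // expn_gt0 d_gt0.
  by rewrite leq_exp2l //; apply: leq_trans.
apply: (colour_union_connected A_gt1) => x i j iA jA.
have [y yx hy] := hP x A i j iA jA leA.
by exists y => //; apply: swap_pair_face.
Qed.

(* Logarithmic bounds *)
From mathcomp Require Import all_classical all_reals all_analysis.
Import Order.TTheory GRing.Theory Num.Theory.
Import numFieldNormedType.Exports.
Local Open Scope classical_set_scope.
Local Open Scope ring_scope.

(** Exponentiating gives d^45 <= 2^n, while 8 d^9 <= d^12 <= d^45. *)
Lemma log2_bound (R : realType) (d n : nat) : (1 < d)%N ->
  45 * log2 d%:R <= n%:R :> R -> (8 * d ^ 9 <= 2 ^ n)%N.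
Proof.
move=> d_gt1; have ln2_gt0 : 0 < ln 2 :> R by rewrite ln_gt0 // ltr1n.
have d_gt0 : 0 < d%:R :> R by rewrite ltr0n ltnW.
rewrite /log2 mulrA ler_pdivrMr // mulr_natl mulr_natl -!lnXn //.
rewrite ler_ln ?posrE ?exprn_gt0 // -!natrX ler_nat; apply: leq_trans.
apply: (@leq_trans (d ^ 3 * d ^ 9)); last by rewrite -expnD leq_exp2l.
by rewrite leq_mul2r (@leq_exp2r 2 d 3) // d_gt1 orbT.
Qed.

Lemma robust_factorisations_45 (R : realType) (d0 : nat) :
  (1 < d0)%N -> robust_factorisations d0 (45 : R).
Proof.
move=> d0_gt1 d le_d; have d_gt1 := leq_trans d0_gt1 le_d.
have [F F1 FP] := robust_factorisation_exists (ltnW d_gt1); exists F => // N NF leN.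
exact: FP NF (log2_bound d_gt1 leN).
Qed.

Lemma r_cube_le (R : realType) (d : nat) : (1 < d)%N ->
  (r_cube d)%:R <= 46 / ln 2 * ln d%:R :> R.
Proof.
move=> d_gt1; have ln2_gt0 : 0 < ln 2 :> R by rewrite ln_gt0 // ltr1n.
have log2_ge1 : 1 <= log2 d%:R :> R.
  by rewrite /log2 ler_pdivlMr // mul1r ler_ln ?posrE ?ltr0n ?(ltnW d_gt1) // ler_nat.
have x_ge0 : 0 <= 45 * log2 d%:R :> R by rewrite mulr_ge0 // (le_trans _ log2_ge1).
(* The successor makes [r] positive and at least 45 log2 d; since log2 d >= 1, it costs one more
   log2 d, whence 46. *)
set r := (Num.truncn (45 * log2 d%:R :> R)).+1.
have adm : admissible d r.
  have [F F1 FP] := robust_factorisation_exists (ltnW d_gt1).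
  apply/andP; split=> //; apply/existsP; exists F; rewrite F1.
  apply/forallP=> N; apply/implyP=> /andP[NF /eqP EN].
  apply: FP NF _; apply: (@log2_bound R) => //; rewrite EN.
  by have /andP[_ /ltW] := truncn_itv x_ge0.
have le_r : (r_cube d <= r)%N.
  by rewrite /r_cube; case: ex_minnP => m _; apply.
apply: (@le_trans _ _ r%:R); first by rewrite ler_nat.
have -> : 46 / ln 2 * ln d%:R = 45 * log2 d%:R + log2 d%:R :> R.
  by rewrite mulrAC -mulrA -/(log2 _) -[46]natr1 mulrDl mul1r.
by rewrite /r -natr1 lerD // truncn_le.
Qed.

Theorem theorem1p2 (R : realType) :
  [/\ exists (d0 : nat) (c : R), robust_factorisations d0 c,
      robust_factorisations 3000 (45 : R) &
      (fun d : nat => (r_cube d)%:R : R) =O_\oo (fun d : nat => ln d%:R : R)].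
Proof.
split; [by exists 2%N, 45; apply: robust_factorisations_45 |
  exact: robust_factorisations_45 |].
apply/eqO_exP; exists (46 / ln 2); first by rewrite divr_gt0 ?ln_gt0 ?ltr1n.
exists 2%N => // d /= d_ge2; rewrite normr_nat; apply: le_trans (r_cube_le R d_ge2) _.
by rewrite ler_wpM2l ?ler_norm // divr_ge0 // ltW // ln_gt0 // ltr1n.
Qed.
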